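(* (1) For $n\ge1$, $V(2+\alpha_{n-1})_{0,2}$ consists of the single point $(a_1,a_2)=(0,0)$. (2) There are no $\mathbb{Z}[\alpha_n]$-PCFs of type $(0,2)$ for $\alpha_{n+1}$, $n\ge0$.
   Context: For $n\ge-1$, $\alpha_n=2\cos(2\pi/2^{n+2})$, so $\alpha_{n+1}^2=2+\alpha_n$. Put $D(c)=\begin{bmatrix}c&1\\1&0\end{bmatrix}$ and $\begin{bmatrix}E_{11}&E_{12}\\ E_{21}&E_{22}\end{bmatrix}=D(x_1)D(x_2)=\begin{bmatrix}x_1x_2+1&x_1\\ x_2&1\end{bmatrix}$. The PCF variety $V(2+\alpha_{m})_{0,2}\subseteq\mathbb{A}^2$, associated with the polynomial $x^2-(2+\alpha_m)$ with roots $\pm\alpha_{m+1}$, is defined by $A(E_{22}-E_{11})=BE_{21}$, $-AE_{12}=CE_{21}$, $-BE_{12}=C(E_{22}-E_{11})$ for $(A,B,C)=(1,0,-(2+\alpha_m))$. ''Consists of'' refers to the set of geometric points. A $\mathbb{Z}[\alpha_n]$-PCF of type $(0,2)$ for $\alpha_{n+1}$ is a periodic continued fraction $[\overline{a_1,a_2}]$ with $a_1,a_2\in\mathbb{Z}[\alpha_n]$ whose value is $\alpha_{n+1}$. Here the partial quotients $c_1,c_2,\ldots$ are $a_1,a_2,a_1,a_2,\ldots$; the $m$-th convergent is $M_{11}/M_{21}\in\mathbb{P}^1(\mathbb{C})$ with $M=D(c_1)\cdots D(c_m)$, and the value is the limit of the convergents in $\mathbb{P}^1(\mathbb{C})$,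 if it exists. *)

(* Defs.v *)
From mathcomp Require Import all_boot all_order all_algebra.
From mathcomp Require Import complex.
From mathcomp Require Import all_classical all_reals all_analysis.

Set Implicit Arguments.
Unset Strict Implicit.
Unset Printing Implicit Defensive.

Import Order.TTheory GRing.Theory Num.Theory numFieldNormedType.Exports.

Local Open Scope ring_scope.
Local Open Scope complex_scope.
Local Open Scope classical_set_scope.

(* The exponent lives in int because the family starts at n = -1; the inner
   [2 ^ _] is the integer power of the real number 2. *)
Definition alpha (R : realType) (n : int) : R :=
  2 * cos (2 * pi / 2 ^ (n + 2)).

Definition D (K : nzRingType) (c : K) : 'M[K]_2 :=
  \matrix_(i, j) nth 0 (nth [::] [:: [:: c; 1]; [:: 1; 0]] i) j.

(* Points with coordinates in [Omega] of the PCF variety of type (0,2)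
   attached to A x^2 + B x + C, where A, B, C lie in a field of definition [k]
   and are mapped to [Omega] by [phi]. Matrix indices start at 0, so that
   E_11, E_12, E_21, E_22 are E 0 0, E 0 1, E 1 0, E 1 1. *)
Definition PCF_variety02 (k Omega : fieldType) (phi : {rmorphism k -> Omega})
    (A B C : k) : set (Omega * Omega) :=
  [set x | let E := D x.1 *m D x.2 in
    [/\ phi A * (E 1 1 - E 0 0) = phi B * E 1 0,
        - (phi A * E 0 1) = phi C * E 1 0 &
        - (phi B * E 0 1) = phi C * (E 1 1 - E 0 0)]].

(* V(b)_{0,2}, attached to x^2 - b. *)
Definition V02 (k Omega : fieldType) (phi : {rmorphism k -> Omega}) (b : k) :
    set (Omega * Omega) :=
  PCF_variety02 phi 1 0 (- b).

(* The ring Z[t] generated by a complex number t. *)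
Definition Zadjoin (R : realType) (t : R[i]) : set R[i] :=
  [set (map_poly intr p).[t] | p in [set: {poly int}]].

(* [R[i]] carries no topology of its own; the topology is found through its
   numClosedFieldType structure. *)
Definition CC (R : realType) : numClosedFieldType := R[i].

(* P^1(C), with its topology, as the one-point compactification of C:
   [Some z] is (z : 1) and [None] is the point at infinity (1 : 0). *)
Definition P1 (R : realType) : topologicalType :=
  one_point_compactification (CC R).

(* The point (p : q). The pair (0, 0) never arises from convergents, whose
   matrices have determinant 1 or -1. *)
Definition P1_point (R : realType) (p q : R[i]) : P1 R :=
  if q == 0 then None else Some (p / q).

(* The sequence of partial quotients is indexed from 0: [c m] is c_{m+1}, and
   [convergent c m] is the m-th convergent, given by D(c_1) ... D(c_m); the
   empty product at m = 0 gives infinity and does not affect the limit. *)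
Definition convergent (R : realType) (c : nat -> R[i]) (m : nat) : P1 R :=
  let M := \prod_(i < m) D (c i) in P1_point (M 0 0) (M 1 0).

Definition has_value (R : realType) (c : nat -> R[i]) (v : P1 R) : Prop :=
  convergent c @ \oo --> v.

Definition periodic02 (R : realType) (a1 a2 : R[i]) (m : nat) : R[i] :=
  if odd m then a2 else a1.

Definition is_PCF02 (R : realType) (S : set R[i]) (t a1 a2 : R[i]) : Prop :=
  [/\ S a1, S a2 & has_value (periodic02 a1 a2) (Some t)].

(* Main.v *)
Require Import Defs.
From mathcomp Require Import all_boot all_order all_algebra.
From mathcomp Require Import complex.
From mathcomp Require Import ring zify.
From mathcomp Require Import all_classical all_reals all_analysis.

Import Order.TTheory GRing.Theory Num.Theory numFieldNormedType.Exports.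

Local Open Scope ring_scope.
Local Open Scope complex_scope.
Local Open Scope classical_set_scope.

(** Membership in V(b)_{0,2} means x1 x2 = 0 and x1 = b x2, and 2 + alpha_(n-1)
    is nonzero; this gives (1). For (2), the value t = alpha_(n+1) of a PCF is
    fixed by the Moebius map D(a1) D(a2), so a2 t^2 - a1 a2 t - a1 = 0, where
    t^2 = 2 + alpha_n lies in Z[alpha_n]. If 2 + alpha_n is not a ratio of
    squares in Z[alpha_n], this forces a1 a2 = 0 and then a1 = a2 = 0, but then
    the convergents of even index are all infinite. That 2 + alpha_n and
    2 - alpha_n are not ratios of squares follows by induction on n, by taking
    norms from Z[alpha_(n+1)] to Z[alpha_n], down to the irrationality of the
    square root of 2. *)

Lemma mulmx_D2 (K : comNzRingType) (a b : K) :
  D a *m D b = \matrix_(i, j)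
    nth 0 (nth [::] [:: [:: a * b + 1; a]; [:: b; 1]] i) j.
Proof.
apply/matrixP => i j; rewrite !mxE !big_ord_recl big_ord0 !mxE /=.
by case: i => [[|[|]] // ?]; case: j => [[|[|]] // ?] /=; ring.
Qed.

(* With [c = 2 + s] the hypothesis [U^2 c = V^2] conjugates to
   [U'^2 (2 - s) = V'^2], and the product of the two is
   [N(U)^2 (2 - r) = N(V)^2], because [(2 + s) (2 - s) = 4 - s^2 = 2 - r]. *)
Lemma square_ratio_step (A : comNzRingType) (K : idomainType)
    (f : {rmorphism A -> K}) (r : A) (s : K) :
  s ^+ 2 = 2 + f r ->
  (forall u v, f u ^+ 2 * (2 + f r) = f v ^+ 2 -> f u = 0) ->
  (forall u v, f u ^+ 2 * (2 - f r) = f v ^+ 2 -> f u = 0) ->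
  forall u0 u1 v0 v1,
    (f u0 + f u1 * s) ^+ 2 * (2 + s) = (f v0 + f v1 * s) ^+ 2 ->
    f u0 + f u1 * s = 0.
Proof.
move=> s2 Hp Hm u0 u1 v0 v1 E.
have fr : f r = s ^+ 2 - 2 by rewrite s2; ring.
(* A relation makes [s ^+ 2 = 2 + f r] a ratio of squares from [A], which [Hp] excludes unless
   [f b = 0]. *)
have indep a b : f a + f b * s = 0 -> f a = 0 /\ f b = 0.
  move=> ab.
  have fb : f b = 0.
    apply: (Hp b a); rewrite -s2 -exprMn -sqrrN; congr (_ ^+ 2).
    by apply/eqP; rewrite eq_sym -addr_eq0 ab.
  by move: ab; rewrite fb mul0r addr0.
(* Coordinates of the squares on [1, s]: [U ^+ 2 = p + q s] and [V ^+ 2 = p' + q' s]. *)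
pose p := u0 ^+ 2 + u1 ^+ 2 * (2 + r); pose q := 2 * u0 * u1.
pose p' := v0 ^+ 2 + v1 ^+ 2 * (2 + r); pose q' := 2 * v0 * v1.
have [] := indep (2 * p + q * (2 + r) - p') (p + 2 * q - q').
  rewrite !(rmorph_nat, rmorphB, rmorphD, rmorphM, rmorphXn) /= fr.
  transitivity ((f u0 + f u1 * s) ^+ 2 * (2 + s) - (f v0 + f v1 * s) ^+ 2).
    by ring.
  by rewrite E subrr.
rewrite !(rmorph_nat, rmorphB, rmorphD, rmorphM, rmorphXn) /= fr => EA EB.
have Econj : (f u0 - f u1 * s) ^+ 2 * (2 - s) = (f v0 - f v1 * s) ^+ 2.
  apply/eqP; rewrite -subr_eq0; apply/eqP.
  by rewrite -[RHS](subr0 0) -{1}EA -(mul0r s) -EB; ring.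
have N0 : f (u0 ^+ 2 - u1 ^+ 2 * (2 + r)) = 0.
  apply: (Hm _ (v0 ^+ 2 - v1 ^+ 2 * (2 + r))).
  rewrite !(rmorph_nat, rmorphB, rmorphD, rmorphM, rmorphXn) /= fr.
  transitivity ((f u0 + f u1 * s) ^+ 2 * (2 + s) *
                ((f u0 - f u1 * s) ^+ 2 * (2 - s))); first by ring.
  by rewrite E Econj; ring.
(* A vanishing norm reads [u1 ^+ 2 * (2 + r) = u0 ^+ 2] under [f], so [Hp] applies once more. *)
have fu1 : f u1 = 0.
  apply: (Hp u1 u0); apply/esym/eqP; rewrite -subr_eq0; move: N0.
  by rewrite !(rmorph_nat, rmorphB, rmorphD, rmorphM, rmorphXn) /= => ->.
move: N0; rewrite !(rmorphB, rmorphD, rmorphM, rmorphXn) /= fu1.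
by rewrite !mul0r subr0 => /eqP; rewrite mulf_eq0 orbb => /eqP ->;
  rewrite addr0.
Qed.

(** Evaluation at [t] as a bundled morphism, so that the [rmorph] lemmas apply; its image is
    Z[t]. *)
Definition int_eval {K : comNzRingType} (t : K) : {rmorphism {poly int} -> K} :=
  horner_eval t \o map_poly intr.

Lemma int_evalE (K : comNzRingType) (t : K) p :
  int_eval t p = (map_poly intr p).[t].
Proof. by []. Qed.

(** Horner's scheme: [(U0 + U1 s) s + c = (U1 (2 + r) + c) + U0 s]. *)
Lemma int_eval_step (K : comNzRingType) (s r : K) (p : {poly int}) :
  s ^+ 2 = 2 + r ->
  exists u0 u1, int_eval s p = int_eval r u0 + int_eval r u1 * s.
Proof.
move=> s2; elim/poly_ind: p => [|p c [u0 [u1 E]]].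
  by exists 0, 0; rewrite !rmorph0 mul0r addr0.
exists (u1 * (2 + 'X) + c%:P), u0.
rewrite !(rmorph_nat, rmorphD, rmorphM) E !int_evalE.
rewrite !map_polyX !map_polyC !hornerX !hornerC /= -s2; ring.
Qed.

Lemma int_eval_opp (K : comNzRingType) (s : K) p :
  exists q, int_eval s p = int_eval (- s) q.
Proof.
exists (p \Po - 'X); rewrite !int_evalE map_comp_poly.
by rewrite rmorphN /= map_polyX horner_comp hornerN hornerX opprK.
Qed.

(** For nonzero [a], the 2-adic valuation is odd on the left and even on the right. *)
Lemma sqrt2_irrat_nat (a b : nat) : (a ^ 2 * 2 = b ^ 2)%N -> a = 0%N.
Proof.
case: a => // a E; have b0 : (0 < b)%N by case: b E => //; lia.
have := congr1 (logn 2) E.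
by rewrite lognM ?expn_gt0 // !lognX (@pfactorK 2 1) // => /(congr1 odd); lia.
Qed.

Lemma square_ratio_tower (K : numDomainType) (a : nat -> K) :
  a 0 = 0 -> (forall n, a n.+1 ^+ 2 = 2 + a n) ->
  forall n u v,
    (int_eval (a n) u ^+ 2 * (2 + a n) = int_eval (a n) v ^+ 2 ->
     int_eval (a n) u = 0) /\
    (int_eval (a n) u ^+ 2 * (2 - a n) = int_eval (a n) v ^+ 2 ->
     int_eval (a n) u = 0).
Proof.
move=> a0 aS; elim=> [|n IH] u v.
  (* At level 0 the ring is Z and both claims concern the number 2. *)
  rewrite a0 subr0 addr0; suff H : int_eval (0 : K) u ^+ 2 * 2 = int_eval (0 : K) v ^+ 2 ->
    int_eval (0 : K) u = 0 by split.
  rewrite !int_evalE !horner_coef0 !coef_map /= => /eqP.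
  have -> : 2 = (2%:~R : K) by [].
  rewrite -!rmorphXn -rmorphM eqr_int => /eqP /(congr1 absz).
  rewrite abszM !abszX => /sqrt2_irrat_nat /eqP; rewrite absz_eq0 => /eqP ->.
  by [].
have X t : int_eval t 'X = t :> K by rewrite int_evalE map_polyX hornerX.
(* Stated for any square root [s] of [2 + a n]: [s = a n.+1] gives the first claim, and
   [s = - a n.+1] the second, as Z[s] = Z[-s]. *)
have step s u' v' : s ^+ 2 = 2 + a n -> int_eval s u' ^+ 2 * (2 + s) =
    int_eval s v' ^+ 2 -> int_eval s u' = 0.
  move=> s2; have [u0 [u1 ->]] := int_eval_step _ _ _ u' s2.
  have [v0 [v1 ->]] := int_eval_step _ _ _ v' s2.
  apply: (@square_ratio_step _ _ (int_eval (a n)) 'X); rewrite X //.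
    by move=> x y; exact: (IH x y).1.
  by move=> x y; exact: (IH x y).2.
split; first exact/step/aS.
have [u' Eu] := int_eval_opp _ (a n.+1) u.
have [v' Ev] := int_eval_opp _ (a n.+1) v.
by rewrite Eu Ev; apply: step; rewrite sqrrN aS.
Qed.

Lemma alpha0 (R : realType) : alpha R 0 = 0.
Proof.
rewrite /alpha add0r; suff -> : 2 * pi / 2 ^ 2 = pi / 2 :> R.
  by rewrite cos_pihalf mulr0.
by rewrite -exprnP; field.
Qed.

Lemma alphaS_sqr (R : realType) (n : int) :
  alpha R (n + 1) ^+ 2 = 2 + alpha R n.
Proof.
rewrite /alpha; set x := 2 * pi / 2 ^ (n + 1 + 2).
have -> : 2 * pi / 2 ^ (n + 2) = x *+ 2.
  rewrite /x addrAC [2 ^ (n + 2 + 1)]expfzDr ?pnatr_eq0 // expr1z.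
  by have ? : 2 ^ (n + 2) != 0 :> R; [rewrite expfz_neq0 ?pnatr_eq0|field].
by rewrite cos_mulr2n; ring.
Qed.

Lemma periodic02_rec (R : realType) (a b : R[i]) m :
  \prod_(i < m.+2) D (periodic02 a b i) =
  D a * (D b * \prod_(i < m) D (periodic02 a b i)).
Proof.
rewrite 2!big_ord_recl /=; congr (_ * (_ * _)).
by apply: eq_bigr => i _; rewrite /periodic02 /= negbK.
Qed.

(** The image under [Some] of a neighbourhood of [t] is a neighbourhood of [Some t] that misses
    infinity, so denominators are eventually nonzero. *)
Lemma cvg_P1_Some (R : realType) (p q : nat -> R[i]) (t : R[i]) :
  (fun m => P1_point (p m) (q m)) @ \oo --> (Some t : P1 R) ->
  (\forall m \near \oo, q m != 0) /\
  ((fun m => p m / q m : CC R) @ \oo --> (t : CC R)).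
Proof.
move=> H.
have K (U : set (CC R)) : nbhs (t : CC R) U ->
    \forall m \near \oo, q m != 0 /\ U (p m / q m).
  move=> tU.
  have /H HU := @one_point_compactification_some_nbhs (CC R) t U tU.
  have {}HU : \forall m \near \oo,
      [set Some x | x in U] (P1_point (p m) (q m)).
    exact: HU.
  apply: filterS HU => m /=.
  by rewrite /P1_point; case: eqP => [_|_] [x Ux] // [<-].
split; last by move=> U /K; apply: filterS => m [].
by apply: filterS (K setT filterT) => m [].
Qed.

Lemma has_value02_fixed (R : realType) (a b t : R[i]) :
  has_value (periodic02 a b) (Some t) ->
  b * t ^+ 2 - a * b * t - a = 0 /\ (a != 0 \/ b != 0).
Proof.
move=> H.
pose M m := \prod_(i < m) D (periodic02 a b i).
have [nq cv] := @cvg_P1_Some R (fun m => M m 0 0) (fun m => M m 1 0) t H.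
have lift01 : lift ord0 ord0 = 1 :> 'I_2 by apply/val_inj.
have Mrec m j : M m.+2 0 j = (a * b + 1) * M m 0 j + a * M m 1 j /\
                M m.+2 1 j = b * M m 0 j + M m 1 j.
  rewrite /M periodic02_rec mulrA -[D a * D b]/(D a *m D b) mulmx_D2 -/(M m).
  by rewrite !mxE !big_ord_recl !big_ord0 !mxE /= !addr0 mul1r lift01.
split.
  pose z m : CC R := M m 0 0 / M m 1 0.
  have cv2 : (fun m => z m.+2) @ \oo --> (t : CC R).
    by move: cv; rewrite -cvg_shiftS -cvg_shiftS.
  have cst (w : CC R) : (fun=> w) @ \oo --> w by exact: cvg_cst.
  (* The Moebius recursion from [z m] to [z m.+2] is taken to the limit with denominators cleared,
     since [b * t + 1] might vanish. *)
  have cvl : (fun m => z m.+2 * (b * z m + 1)) @ \oo -->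
      (t * (b * t + 1) : CC R).
    exact: (cvgM cv2 (cvgD (cvgM (cst b) cv) (cst 1))).
  have cvr : (fun m => (a * b + 1) * z m + a) @ \oo -->
      ((a * b + 1) * t + a : CC R).
    exact: (cvgD (cvgM (cst (a * b + 1)) cv) (cst a)).
  have E : \forall m \near \oo,
      (a * b + 1) * z m + a = z m.+2 * (b * z m + 1).
    have nq2 : \forall m \near \oo, M m.+2 1 0 != 0.
      case: nq => N _ nq; exists N => // m /= Nm.
      by apply: nq; rewrite /= 2?ltnW.
    apply: filterS2 nq nq2 => m q0; have [Mp Mq] := Mrec m 0.
    by rewrite /z Mp Mq => q2; field; rewrite q0 q2.
  have : t * (b * t + 1) = (a * b + 1) * t + a.
    apply: (cvg_unique (@norm_hausdorff _ (CC R)) cvl).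
    apply: cvg_trans cvr; exact: near_eq_cvg E.
  by move=> Et; transitivity (t * (b * t + 1) - ((a * b + 1) * t + a));
    [ring|rewrite Et subrr].
apply/orP; rewrite -negb_and; apply/negP => /andP[/eqP a0 /eqP b0].
have q0 m : M m.*2 1 0 = 0.
  elim: m => [|m IH]; first by rewrite /M big_ord0 mxE.
  by rewrite doubleS (Mrec _ _).2 b0 mul0r add0r.
case: nq => N _ /(_ N.*2); rewrite /= q0 eqxx => /(_ _)/negP; apply => //.
by rewrite -addnn leq_addr.
Qed.

Theorem proposition5p2 (R : realType) :
  (forall n : int, 1 <= n ->
     forall (k : fieldType) (iota : {rmorphism k -> R[i]}) (a : k),
       iota a = (alpha R (n - 1))%:C ->
     forall (Omega : closedFieldType) (phi : {rmorphism k -> Omega}),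
       V02 phi (2 + a) = [set (0, 0)])
  /\
  (forall n : int, 0 <= n ->
     ~ exists a1 a2 : R[i],
         is_PCF02 (Zadjoin (alpha R n)%:C) (alpha R (n + 1))%:C a1 a2).
Proof.
pose al n := (alpha R n%:Z)%:C.
have al0 : al 0%N = 0 by rewrite /al alpha0.
have alS n : al n.+1 ^+ 2 = 2 + al n.
  by rewrite /al -addn1 PoszD -rmorphXn /= alphaS_sqr rmorphD rmorph_nat.
have nonsq n u v := (square_ratio_tower _ al al0 alS n u v).1.
(* If it vanished, [u = 1] and [v = 0] in [nonsq] would give [1 = 0]. *)
have al_neq n : 2 + al n != 0.
  apply/eqP => E; have := nonsq n 1 0.
  by rewrite E mulr0 rmorph0 expr0n rmorph1 => /(_ erefl)/eqP; rewrite oner_eq0.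
split=> [[[|n]|//] // _ k iota a ia Omega phi|[n|//] _ [a1 [a2 []]]].
  (* Field morphisms are injective, so nonvanishing passes from the complex numbers back to [k] and
     on to [Omega]. *)
  have b0 : phi (2 + a) != 0.
    rewrite fmorph_eq0 -(fmorph_eq0 iota) rmorphD rmorph_nat ia.
    have -> : n.+1%:Z - 1 = n by lia.
    exact: al_neq.
  rewrite /V02 /PCF_variety02; apply/seteqP; split=> -[x y] /=;
    rewrite mulmx_D2 !mxE /= rmorph1 rmorph0 rmorphN; last first.
    by case=> -> ->; split; ring.
  rewrite !mul1r mul0r mulNr => -[xy0 /oppr_inj xE _].
  have y0 : y = 0.
    have : phi (2 + a) * y ^+ 2 = 0 by rewrite -[RHS]oppr0 -xy0 xE; ring.
    by move/eqP; rewrite mulf_eq0 (negPf b0) sqrf_eq0 => /eqP.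
  by rewrite xE y0 mulr0.
have t0 : al n.+1 != 0 by rewrite -sqrf_eq0 alS.
move=> [p _ <-] [q _ <-]; rewrite -PoszD addn1 -/(al n.+1).
move=> /(has_value02_fixed _ _ _ _) [].
rewrite -!int_evalE; set a := int_eval _ p; set b := int_eval _ q => E nz.
have bt : b * al n.+1 ^+ 2 - a = a * b * al n.+1.
  by apply/eqP; rewrite -subr_eq0 addrAC E.
(* As [al n.+1 ^+ 2 = 2 + al n], the polynomial [q * (2 + 'X) - p] takes the value
   [b * al n.+1 ^+ 2 - a] at [al n]; squaring [bt] then exhibits [2 + al n] as a ratio of squares if
   [a * b] is nonzero. *)
have ab0 : a * b = 0.
  have := nonsq n (p * q) (q * (2 + 'X) - p).
  rewrite !(rmorphB, rmorphM, rmorphD) rmorph1 -/a -/b.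
  rewrite int_evalE map_polyX hornerX.
  by apply; rewrite -alS bt -exprMn.
move: bt; rewrite ab0 mul0r => /eqP; rewrite subr_eq0 => /eqP bt.
move/eqP: ab0; rewrite mulf_eq0 => /orP[] /eqP z0; case: nz; rewrite ?z0 ?eqxx //.
  by have /eqP := bt; rewrite z0 mulf_eq0 sqrf_eq0 (negPf t0) orbF => ->.
by rewrite -bt z0 mul0r eqxx.
Qed.
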